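(* For all integers $m,k,p\ge 0$, \begin{align*} &(-1)^{k+p}(m+1)!(k+1)!\sum_{i=0}^{m}\frac{(\ln 2)^i}{i!}\zeta(\bar 1,\{1\}_{m-i},2,\{1\}_p,2,\{1\}_k)\\ &+(-1)^{m+1}(k+1)!(m+1)!\sum_{i=0}^{k}\frac{(\ln 2)^i}{i!}\zeta(\bar 1,\{1\}_{k-i},2,\{1\}_p,2,\{1\}_m)\\ &+(-1)^{k+p}(k+1)!(\ln 2)^{m+1}\zeta(\bar 2,\{1\}_p,2,\{1\}_k)+(-1)^{m+1}(m+1)!(\ln 2)^{k+1}\zeta(\bar 2,\{1\}_p,2,\{1\}_m)\\ &=(-1)^{m+k+p+1}(m+1)!(k+1)!\,\zeta(\bar 2,\{1\}_m)\,\zeta(\bar 1,\{1\}_p,2,\{1\}_k)\\ &\quad+(-1)^{m+k}(k+1)!(m+1)!\,\zeta(\bar 2,\{1\}_k)\,\zeta(\bar 1,\{1\}_p,2,\{1\}_m)\\ &\quad+(-1)^{m+k+p+1}(k+1)!(m+1)!\sum_{i=1}^{p}(-1)^i\zeta(\bar 1,\{1\}_{i-1},2,\{1\}_m)\,\zeta(\bar 1,\{1\}_{p-i},2,\{1\}_k). \end{align*}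
   Context: For nonzero integers $s_1,\dots,s_k$, with $\operatorname{sgn}(s)=1$ if $s>0$ and $-1$ if $s<0$, the multiple zeta value is $\zeta(s_1,\dots,s_k)=\sum_{n_1>n_2>\cdots>n_k\ge 1}\prod_{j=1}^k n_j^{-|s_j|}\operatorname{sgn}(s_j)^{n_j}$. A barred entry $\bar q$ denotes the negative entry $-q$. The notation $\{1\}_d$ means the entry $1$ repeated $d$ times ($d=0$ means no entries). An empty sum is $0$. *)

(* Defs.v *)
From Stdlib Require Import Reals ZArith List.
From Coquelicot Require Import Coquelicot.
Open Scope R_scope.

Definition mzv_term (s : Z) (n : nat) : R :=
  (if (0 <? s)%Z then 1 else (-1) ^ n) / (INR n) ^ (Z.abs_nat s).

(* Truncated sum: sum over N >= n1 > n2 > ... > nk >= 1. *)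
Fixpoint mzv_trunc (s : list Z) (N : nat) : R :=
  match s with
  | nil => 1
  | s1 :: rest =>
      fold_right Rplus 0
        (map (fun n => mzv_term s1 n * mzv_trunc rest (n - 1)) (seq 1 N))
  end.

Definition mzv (s : list Z) : R := real (Lim_seq (fun N => mzv_trunc s N)).

Definition ones (d : nat) : list Z := repeat 1%Z d.

Definition sum_range (a n : nat) (f : nat -> R) : R :=
  fold_right Rplus 0 (map f (seq a n)).

(* Main.v *)
Require Import Defs.
From Stdlib Require Import Reals ZArith List Lra Lia.
From Coquelicot Require Import Coquelicot.
Import ListNotations.
Open Scope R_scope.

(* For 0 <= t <= 1 let L_s(t) be the multiple polylogarithm of index s at -t: an
   iterated integral in the forms dt/t and -dt/(1+t), whose value at t = 1 is the
   alternating zeta value.  Replace ln 2 by ln(1+t) and every zeta value by L_s(t)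
   and put F_i = L_({1}_i,2,{1}_m), G_i = L_({1}_i,2,{1}_k).  Since
   F_(i+1)' = -F_i/(1+t), the derivative of sum_(i=0)^(p+1) (-1)^i F_i G_(p+1-i)
   telescopes to F_0' G_(p+1) + (-1)^(p+1) F_(p+1) G_0'.  In the same way the sums
   with powers of the logarithm have derivatives
   ln(1+t)^(m+1)/(m+1)! * G_(p+1)/t and ln(1+t)^(k+1)/(k+1)! * F_(p+1)/t.  As
   ln(1+t)^n/n! = (-1)^n L_({1}_n), both sides have the same derivative, and both
   vanish at t = 0.

   To reach t = 1 without Abel's theorem, the N-th partial sums are compared with
   the iterated integrals on all of [0,1], with error at most eps_N * t where
   eps_N -> 0; integrating against -dt/(1+t) adds an error T_N/(N+1), T_N being
   the truncated zeta value, which tends to 0 by Cesaro. *)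

(** * Finite sums over integer ranges *)

Lemma sum_range_S (a n : nat) (f : nat -> R) :
  sum_range a (S n) f = f a + sum_range (S a) n f.
Proof. reflexivity. Qed.

Lemma sum_range_Sr (a n : nat) (f : nat -> R) :
  sum_range a (S n) f = sum_range a n f + f (a + n)%nat.
Proof.
  revert a; induction n as [|n IH]; intros a.
  - unfold sum_range; simpl. rewrite Nat.add_0_r. ring.
  - rewrite sum_range_S, IH, (sum_range_S a n). rewrite <- plus_n_Sm. simpl. ring.
Qed.

Lemma sum_range_ext (a n : nat) (f g : nat -> R) :
  (forall i, (a <= i < a + n)%nat -> f i = g i) -> sum_range a n f = sum_range a n g.
Proof.
  revert a; induction n as [|n IH]; intros a H; [reflexivity|].
  rewrite !sum_range_S. rewrite (H a) by lia. f_equal. apply IH. intros; apply H; lia.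
Qed.

Lemma sum_range_shift (a n : nat) (f : nat -> R) :
  sum_range (S a) n f = sum_range a n (fun i => f (S i)).
Proof.
  revert a; induction n as [|n IH]; intros a; [reflexivity|].
  rewrite !sum_range_S. now rewrite IH.
Qed.

Lemma sum_range_scal (a n : nat) (c : R) (f : nat -> R) :
  sum_range a n (fun i => c * f i) = c * sum_range a n f.
Proof.
  induction n as [|n IH]; [unfold sum_range; simpl; ring|].
  rewrite !sum_range_Sr, IH. ring.
Qed.

Lemma sum_range_plus (a n : nat) (f g : nat -> R) :
  sum_range a n (fun i => f i + g i) = sum_range a n f + sum_range a n g.
Proof.
  induction n as [|n IH]; [unfold sum_range; simpl; ring|].
  rewrite !sum_range_Sr, IH. ring.
Qed.

Lemma sum_range_le (a n : nat) (f g : nat -> R) :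
  (forall i, f i <= g i) -> sum_range a n f <= sum_range a n g.
Proof.
  intros H. induction n as [|n IH]; [apply Rle_refl|].
  rewrite !sum_range_Sr. apply Rplus_le_compat; auto.
Qed.

Lemma sum_range_sum_f_R0 (n : nat) (f : nat -> R) :
  sum_range 0 (S n) f = sum_f_R0 f n.
Proof.
  induction n as [|n IH]; [unfold sum_range; simpl; ring|].
  rewrite sum_range_Sr, IH. reflexivity.
Qed.

Lemma is_derive_sum_range (a n : nat) (f df : nat -> R -> R) (t : R) :
  (forall i, (a <= i < a + n)%nat -> is_derive (f i) t (df i t)) ->
  is_derive (fun u => sum_range a n (fun i => f i u)) t
            (sum_range a n (fun i => df i t)).
Proof.
  revert a; induction n as [|n IH]; intros a H.
  - apply (is_derive_const 0).
  - apply (is_derive_plus (f a) (fun u => sum_range (S a) n (fun i => f i u))).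
    + apply H; lia.
    + apply IH. intros; apply H; lia.
Qed.

(** * Integration against the two forms, and the polylogarithms built from it *)

Definition int1 (g : R -> R) (t : R) : R := RInt (fun s => - g s / (1 + s)) 0 t.

(** When [g 0 = 0], this is the continuous extension of [g s / s] through [0], so that integrals
    against [dt / t] are proper. *)
Definition slope (g : R -> R) (s : R) : R :=
  if Req_EM_T s 0 then Derive g 0 else g s / s.

Definition int0 (g : R -> R) (t : R) : R := RInt (slope g) 0 t.

(** Working on the open half-line above [-1], where [1 + t] stays positive, gives two-sided
    derivatives at both ends of [[0,1]]. *)
Lemma is_derive_RInt_from_0 (f : R -> R) (t : R) :
  (forall s, -1 < s -> continuous f s) -> -1 < t ->
  is_derive (fun u => RInt f 0 u) t (f t).
Proof.
  intros Hf Ht. apply (is_derive_RInt f (fun u => RInt f 0 u) 0 t).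
  - apply (locally_interval _ t (Finite (-1)) p_infty); simpl; auto.
    intros y Hy _. apply (RInt_correct f 0 y), (ex_RInt_continuous f).
    intros z Hz. apply Hf. unfold Rmin in Hz; destruct (Rle_dec 0 y); lra.
  - now apply Hf.
Qed.

Lemma is_derive_int1 (g : R -> R) (t : R) :
  (forall s, -1 < s -> ex_derive g s) -> -1 < t ->
  is_derive (int1 g) t (- g t / (1 + t)).
Proof.
  intros Hg Ht. apply (is_derive_RInt_from_0 (fun s => - g s / (1 + s))); auto.
  intros s Hs. apply (ex_derive_continuous (fun s => - g s / (1 + s))).
  auto_derive. split; [now apply Hg|split; [lra|auto]].
Qed.

(** At [0] this is the definition of the derivative of [g]; at any other point [slope g] agrees
    nearby with a quotient of differentiable functions. *)
Lemma continuous_slope (g : R -> R) (t : R) :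
  g 0 = 0 -> ex_derive g 0 -> ex_derive g t -> continuous (slope g) t.
Proof.
  intros H0 Hd0 Hdt. destruct (Req_EM_T t 0) as [->|Hne].
  - apply Derive_correct, is_derive_Reals in Hd0.
    apply filterlim_locally. intros eps.
    destruct (Hd0 eps (cond_pos eps)) as [d Hd]. exists d. intros y Hy.
    change (Rabs (y - 0) < d) in Hy. change (Rabs (slope g y - slope g 0) < eps).
    unfold slope. destruct (Req_EM_T 0 0) as [_|]; [|lra].
    destruct (Req_EM_T y 0) as [_|Hy0].
    + rewrite Rminus_diag, Rabs_R0. apply cond_pos.
    + rewrite Rminus_0_r in Hy. specialize (Hd y Hy0 Hy).
      now rewrite Rplus_0_l, H0, Rminus_0_r in Hd.
  - apply (continuous_ext_loc _ (fun s => g s / s)).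
    + destruct (Rtotal_order t 0) as [Ht|[Ht|Ht]]; [|lra|].
      * apply (locally_interval _ t m_infty (Finite 0)); simpl; auto.
        intros y _ Hy. unfold slope. destruct (Req_EM_T y 0); [simpl in Hy; lra|reflexivity].
      * apply (locally_interval _ t (Finite 0) p_infty); simpl; auto.
        intros y Hy _. unfold slope. destruct (Req_EM_T y 0); [simpl in Hy; lra|reflexivity].
    + apply (ex_derive_continuous (fun s => g s / s)).
      auto_derive. auto.
Qed.

Lemma is_derive_int0 (g : R -> R) (t : R) :
  g 0 = 0 -> (forall s, -1 < s -> ex_derive g s) -> -1 < t ->
  is_derive (int0 g) t (slope g t).
Proof.
  intros H0 Hg Ht. apply is_derive_RInt_from_0; auto.
  intros s Hs. apply continuous_slope; auto. apply Hg; lra.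
Qed.

(* [li s t] is the multiple polylogarithm of index [|s|] at the point [-t]; the
   signs of [s] are ignored. *)
Fixpoint li (s : list Z) : R -> R :=
  match s with
  | nil => fun _ => 1
  | s1 :: rest => Nat.iter (pred (Z.abs_nat s1)) int0 (int1 (li rest))
  end.

(** The two conclusions are proved together because each further [int0] needs both: a zero at the
    origin and differentiability of the function under the integral. *)
Lemma iter_int0_regular (q : nat) (g : R -> R) :
  (forall t, -1 < t -> ex_derive g t) ->
  Nat.iter q int0 (int1 g) 0 = 0 /\
  forall t, -1 < t -> ex_derive (Nat.iter q int0 (int1 g)) t.
Proof.
  intros Hg. induction q as [|q [IH0 IH]]; simpl; split.
  - apply (RInt_point 0 (fun s => - g s / (1 + s))).
  - intros t Ht. eexists. apply is_derive_int1; auto.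
  - apply (RInt_point 0 (slope _)).
  - intros t Ht. eexists. apply is_derive_int0; auto.
Qed.

Lemma ex_derive_li (s : list Z) (t : R) : -1 < t -> ex_derive (li s) t.
Proof.
  revert t; induction s as [|s1 rest IH]; intros t Ht.
  - apply ex_derive_const.
  - now apply iter_int0_regular.
Qed.

Lemma li_0 (s1 : Z) (rest : list Z) : li (s1 :: rest) 0 = 0.
Proof. apply iter_int0_regular, ex_derive_li. Qed.

Lemma is_derive_li_1 (rest : list Z) (t : R) : -1 < t ->
  is_derive (li (1%Z :: rest)) t (- li rest t / (1 + t)).
Proof. intros Ht. apply is_derive_int1; auto. apply ex_derive_li. Qed.

Lemma is_derive_li_ones (i : nat) (s : list Z) (t : R) : -1 < t ->
  is_derive (li (ones (S i) ++ s)) t (- / (1 + t) * li (ones i ++ s) t).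
Proof.
  intros Ht. evar_last; [now apply (is_derive_li_1 (ones i ++ s))|].
  unfold Rdiv. ring.
Qed.

Lemma is_derive_li_2 (rest : list Z) (t : R) : -1 < t ->
  is_derive (li (2%Z :: rest)) t (slope (li (1%Z :: rest)) t).
Proof.
  intros Ht. apply is_derive_int0; auto.
  - apply li_0.
  - apply (ex_derive_li (1%Z :: rest)).
Qed.

(** * Comparison of partial sums with iterated integrals *)

(** The mean value theorem is applied to [e + d] and [e - d]. Its intermediate point is interior, so
    the bound on derivatives is asked only there, away from the special value of [slope] at [0]. *)
Lemma Rabs_le_of_derive (d dd e de : R -> R) (t : R) :
  (forall s, 0 <= s <= t -> is_derive d s (dd s)) ->
  (forall s, 0 <= s <= t -> is_derive e s (de s)) ->
  (forall s, 0 < s < t -> Rabs (dd s) <= de s) ->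
  d 0 = 0 -> e 0 = 0 -> 0 <= t -> Rabs (d t) <= e t.
Proof.
  intros Hd He Hle Hd0 He0 Ht.
  destruct (Req_dec t 0) as [->|Hne]; [rewrite Hd0, He0, Rabs_R0; lra|].
  assert (Hm : forall c, Rabs c = 1 -> 0 <= e t + c * d t).
  { intros c Hc.
    destruct (MVT_cor2 (fun s => e s + c * d s) (fun s => de s + c * dd s) 0 t)
      as [x [Hx Hx']]; [lra| |].
    - intros s Hs. apply is_derive_Reals. apply (is_derive_plus e (fun s => c * d s)).
      + now apply He.
      + apply (is_derive_scal d). now apply Hd.
    - rewrite Hd0, He0 in Hx. specialize (Hle x Hx').
      assert (Hc' : - Rabs (c * dd x) <= c * dd x) by (pose proof (Rle_abs (- (c * dd x))); rewrite Rabs_Ropp in H; lra).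
      rewrite Rabs_mult, Hc in Hc'.
      assert (0 <= (de x + c * dd x) * (t - 0)) by (apply Rmult_le_pos; lra). lra. }
  apply Rabs_le. split.
  - generalize (Hm 1 Rabs_R1). lra.
  - generalize (Hm (-1)). rewrite Rabs_m1. intros H. specialize (H eq_refl). lra.
Qed.

(** The outermost summation variable is [S j], which leaves [j] as the bound for the inner
    variables; [t = 1] gives the truncated zeta value with a barred first entry. *)
Definition partial (q : nat) (rest : list Z) (N : nat) (t : R) : R :=
  sum_range 0 N (fun j => (- t) ^ S j / INR (S j) ^ q * mzv_trunc rest j).

Definition approx (s : list Z) (N : nat) (t : R) : R :=
  match s with nil => 1 | s1 :: rest => partial (Z.abs_nat s1) rest N t end.

Lemma mzv_trunc_cons (s1 : Z) (rest : list Z) (N : nat) :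
  mzv_trunc (s1 :: rest) N =
  sum_range 0 N (fun j => mzv_term s1 (S j) * mzv_trunc rest j).
Proof.
  change (sum_range 1 N (fun n => mzv_term s1 n * mzv_trunc rest (n - 1)) =
    sum_range 0 N (fun j => mzv_term s1 (S j) * mzv_trunc rest j)).
  rewrite sum_range_shift. apply sum_range_ext. intros i _.
  replace (S i - 1)%nat with i by lia. reflexivity.
Qed.

Lemma mzv_trunc_neg (s1 : Z) (rest : list Z) (N : nat) : (s1 < 0)%Z ->
  mzv_trunc (s1 :: rest) N = partial (Z.abs_nat s1) rest N 1.
Proof.
  intros Hs. rewrite mzv_trunc_cons. apply sum_range_ext. intros i _.
  unfold mzv_term. destruct (Z.ltb_spec 0 s1); [lia|]. reflexivity.
Qed.

Lemma mzv_term_pos (s : Z) (n : nat) : (0 < s)%Z ->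
  mzv_term s n = 1 / INR n ^ Z.abs_nat s.
Proof.
  intros Hs. unfold mzv_term. destruct (Z.ltb_spec 0 s); [reflexivity|lia].
Qed.

Lemma is_derive_partial (q : nat) (rest : list Z) (N : nat) (t : R) :
  is_derive (partial (S q) rest N) t
    (- sum_range 0 N (fun j => (- t) ^ j / INR (S j) ^ q * mzv_trunc rest j)).
Proof.
  replace (- sum_range 0 N _) with
    (sum_range 0 N (fun j => - ((- t) ^ j / INR (S j) ^ q * mzv_trunc rest j))).
  - apply (is_derive_sum_range 0 N
      (fun j t => (- t) ^ S j / INR (S j) ^ S q * mzv_trunc rest j)
      (fun j t => - ((- t) ^ j / INR (S j) ^ q * mzv_trunc rest j))).
    intros j _. assert (Hj : INR (S j) <> 0) by (apply not_0_INR; lia).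
    assert (Hq : INR (S j) ^ q <> 0) by now apply pow_nonzero.
    evar_last.
    + apply (is_derive_ext (fun t => (mzv_trunc rest j / INR (S j) ^ S q) * (- t) ^ S j)).
      { intros u. match goal with |- ?a = ?b => change (@eq R a b) end. unfold Rdiv. ring. }
      apply (is_derive_scal (fun t => (- t) ^ S j)).
      apply (is_derive_pow (fun t => - t) (S j) t (-1)).
      auto_derive; auto; ring.
    + cbn [pred]. rewrite <- (tech_pow_Rmult (INR (S j)) q). field. auto.
  - transitivity (-1 * sum_range 0 N (fun j => (- t) ^ j / INR (S j) ^ q * mzv_trunc rest j)); [|ring].
    rewrite <- sum_range_scal. apply sum_range_ext. intros. ring.
Qed.

(** The cofactor of [t] is the derivative of the partial sum of exponent [S q], so integrating
    against [dt / t] raises the exponent by one. *)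
Lemma partial_factor (q : nat) (rest : list Z) (N : nat) (t : R) :
  partial q rest N t =
  t * - sum_range 0 N (fun j => (- t) ^ j / INR (S j) ^ q * mzv_trunc rest j).
Proof.
  replace (t * - _) with ((- t) * sum_range 0 N (fun j => (- t) ^ j / INR (S j) ^ q * mzv_trunc rest j)) by ring.
  rewrite <- sum_range_scal. apply sum_range_ext. intros.
  rewrite <- tech_pow_Rmult. unfold Rdiv. ring.
Qed.

Lemma partial_0 (q : nat) (rest : list Z) (N : nat) : partial q rest N 0 = 0.
Proof. rewrite partial_factor. ring. Qed.

(** Abel summation: the factor [1 + t] turns the coefficients [T j] into their differences. *)
Lemma sum_by_parts (T : nat -> R) (N : nat) (t : R) :
  (1 + t) * sum_range 0 N (fun j => (- t) ^ j * T j) =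
  T 0%nat + sum_range 0 N (fun j => (- t) ^ S j * (T (S j) - T j)) - (- t) ^ N * T N.
Proof.
  induction N as [|N IH]; [unfold sum_range; simpl; ring|].
  rewrite !sum_range_Sr, Rmult_plus_distr_l, IH, Nat.add_0_l.
  rewrite <- !tech_pow_Rmult. ring.
Qed.

(** Successive truncations differ by a single term, so summation by parts yields the partial sum for
    [s] and one boundary term. For the empty word the differences vanish and the initial value [1]
    remains; otherwise the initial value is [0]. *)
Lemma sum_trunc (s : list Z) (N : nat) (t : R) : List.Forall (Z.lt 0) s ->
  (1 + t) * sum_range 0 N (fun j => (- t) ^ j * mzv_trunc s j) =
  approx s N t - (- t) ^ N * mzv_trunc s N.
Proof.
  intros Hs. rewrite sum_by_parts. f_equal. destruct Hs as [|s1 rest Hs1 _].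
  - simpl. rewrite (sum_range_ext 0 N _ (fun j => 0 * 1)) by (intros; ring).
    rewrite sum_range_scal. ring.
  - replace (mzv_trunc (s1 :: rest) 0) with 0 by reflexivity.
    rewrite Rplus_0_l. apply sum_range_ext. intros i _.
    rewrite !mzv_trunc_cons, sum_range_Sr, Nat.add_0_l, mzv_term_pos by auto.
    unfold Rdiv. ring.
Qed.

Lemma mzv_trunc_nonneg (s : list Z) (N : nat) : List.Forall (Z.lt 0) s -> 0 <= mzv_trunc s N.
Proof.
  intros Hs; revert N; induction Hs as [|s1 rest Hs1 _ IH]; intros N; [simpl; lra|].
  rewrite mzv_trunc_cons.
  transitivity (sum_range 0 N (fun _ => 0 * 0)); [rewrite sum_range_scal; lra|].
  apply sum_range_le. intros i. rewrite mzv_term_pos by auto.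
  rewrite Rmult_0_l. apply Rmult_le_pos; auto. apply Rdiv_le_0_compat; [lra|].
  apply pow_lt, lt_0_INR. lia.
Qed.

(** Since [n ^ |s1| >= n], the quotient for [s1 :: rest] is at most a Cesaro mean of the quotients
    for [rest], which tend to [0] by induction. *)
Lemma mzv_trunc_sublinear (s : list Z) : List.Forall (Z.lt 0) s ->
  is_lim_seq (fun N => mzv_trunc s N / INR (S N)) 0.
Proof.
  intros Hs; induction Hs as [|s1 rest Hs1 Hr IH].
  - apply (is_lim_seq_incr_1 (fun N => 1 / INR N)).
    apply (is_lim_seq_ext (fun N => / INR N)).
    + intros n. unfold Rdiv. ring.
    + apply (is_lim_seq_inv INR p_infty); [apply is_lim_seq_INR|discriminate].
  - apply is_lim_seq_Reals, Cesaro_1, is_lim_seq_Reals, is_lim_seq_incr_1 in IH.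
    refine (is_lim_seq_le_le (fun _ => 0) _ _ 0 _ (is_lim_seq_const 0) IH).
    intros N. simpl pred. assert (HN : 0 < INR (S N)) by (apply lt_0_INR; lia).
    split; [apply Rdiv_le_0_compat; auto; apply mzv_trunc_nonneg; auto|].
    apply Rmult_le_compat_r; [left; now apply Rinv_0_lt_compat|].
    (* The Cesaro mean has one summand more than the truncated value, at [j = N]; it is
       nonnegative. *)
    rewrite <- sum_range_sum_f_R0, sum_range_Sr, mzv_trunc_cons.
    rewrite Nat.add_0_l. rewrite <- (Rplus_0_r (sum_range 0 N (fun j => mzv_term _ _ * _))).
    apply Rplus_le_compat.
    + apply sum_range_le. intros i. rewrite mzv_term_pos by auto.
      unfold Rdiv. rewrite Rmult_comm, Rmult_1_l.
      apply Rmult_le_compat_l; [now apply mzv_trunc_nonneg|].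
      assert (H1 : 1 <= INR (S i)) by (apply (le_INR 1); lia).
      apply Rinv_le_contravar; [lra|].
      rewrite <- (pow_1 (INR (S i))) at 1. apply Rle_pow; auto. lia.
    + apply Rdiv_le_0_compat; auto. now apply mzv_trunc_nonneg.
Qed.

(* The factor [t] lets the estimate survive integration against [dt / t]. *)
Lemma partial_approximates_iter (q : nat) (s : list Z) : List.Forall (Z.lt 0) s ->
  (exists eps, is_lim_seq eps 0 /\
     forall N t, 0 <= t <= 1 -> Rabs (approx s N t - li s t) <= eps N) ->
  exists eps, is_lim_seq eps 0 /\
    forall N t, 0 <= t <= 1 ->
      Rabs (partial (S q) s N t - Nat.iter q int0 (int1 (li s)) t) <= eps N * t.
Proof.
  intros Hs [eps [Heps Happ]].
  (* The second summand is the integral over [[0,1]] of the boundary term [T * t ^ N] left by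
     summation by parts. *)
  exists (fun N => eps N + mzv_trunc s N / INR (S N)). split.
  { evar_last; [apply is_lim_seq_plus'; [apply Heps|now apply mzv_trunc_sublinear]|].
    f_equal; ring. }
  intros N. set (T := mzv_trunc s N).
  assert (HT : 0 <= T) by now apply mzv_trunc_nonneg.
  assert (HN : 0 < INR (S N)) by (apply lt_0_INR; lia).
  induction q as [|q IH]; intros t Ht.
  (* This sharper bound is the one whose derivative dominates; [t ^ S N <= t] on [[0,1]] then gives
     the linear bound. *)
  - transitivity (eps N * t + T / INR (S N) * t ^ S N).
    + apply (Rabs_le_of_derive
        (fun t => partial 1 s N t - int1 (li s) t)
        (fun t => - sum_range 0 N (fun j => (- t) ^ j / INR (S j) ^ 0 * mzv_trunc s j)
                  - (- li s t / (1 + t)))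
        (fun t => eps N * t + T / INR (S N) * t ^ S N)
        (fun t => eps N + T * t ^ N)).
      * intros x Hx. apply (is_derive_minus (partial 1 s N) (int1 (li s))).
        -- apply is_derive_partial.
        -- apply is_derive_int1; [apply ex_derive_li|lra].
      * intros x Hx. auto_derive; auto.
        change (match N with 0%nat => 1 | S _ => INR N + 1 end) with (INR (S N)).
        field. lra.
      * intros x Hx.
        rewrite (sum_range_ext 0 N _ (fun j => (- x) ^ j * mzv_trunc s j))
          by (intros; simpl; field).
        replace (sum_range 0 N (fun j => (- x) ^ j * mzv_trunc s j)) with
          ((approx s N x - (- x) ^ N * T) / (1 + x))
          by (rewrite <- sum_trunc by auto; field; lra).
        replace (_ - _) with (- ((approx s N x - li s x) - (- x) ^ N * T) * / (1 + x))
          by (field; lra).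
        rewrite Rabs_mult, Rabs_Ropp.
        transitivity (Rabs ((approx s N x - li s x) - (- x) ^ N * T) * 1).
        -- apply Rmult_le_compat_l; [apply Rabs_pos|].
           rewrite Rabs_pos_eq; [|left; apply Rinv_0_lt_compat; lra].
           rewrite <- Rinv_1. apply Rinv_le_contravar; lra.
        -- rewrite Rmult_1_r. eapply Rle_trans; [apply Rabs_triang|].
           rewrite Rabs_Ropp, (Rabs_mult _ T), (Rabs_pos_eq T), <- RPow_abs, Rabs_Ropp, (Rabs_pos_eq x) by lra.
           assert (Hb := Happ N x). lra.
      * rewrite partial_0. replace (int1 (li s) 0) with 0 by (symmetry; exact (li_0 1 s)). ring.
      * rewrite pow_i by lia. ring.
      * apply Ht.
    + rewrite Rmult_plus_distr_r. apply Rplus_le_compat_l.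
      apply Rmult_le_compat_l; [apply Rdiv_le_0_compat; lra|].
      rewrite <- tech_pow_Rmult. rewrite <- (Rmult_1_r t) at 3.
      apply Rmult_le_compat_l; [lra|]. rewrite <- (pow1 N). apply pow_incr. lra.
  - destruct (iter_int0_regular q (li s) (fun t => ex_derive_li s t)) as [H0 Hreg].
    set (g := Nat.iter q int0 (int1 (li s))) in *. simpl Nat.iter. fold g.
    apply (Rabs_le_of_derive
      (fun t => partial (S (S q)) s N t - int0 g t)
      (fun t => - sum_range 0 N (fun j => (- t) ^ j / INR (S j) ^ S q * mzv_trunc s j)
                - slope g t)
      (fun t => (eps N + T / INR (S N)) * t)
      (fun _ => eps N + T / INR (S N))).
    + intros x Hx. apply (is_derive_minus (partial (S (S q)) s N) (int0 g)).
      * apply is_derive_partial.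
      * apply is_derive_int0; auto. lra.
    + intros x Hx. generalize (eps N + T / INR (S N)). intros C. auto_derive; auto. ring.
    (* Here [x > 0], so [slope] is a true quotient; after multiplication by [x] the claim is the
       induction hypothesis. *)
    + intros x Hx. unfold slope. destruct (Req_EM_T x 0) as [|_]; [lra|].
      specialize (IH x). rewrite partial_factor in IH.
      apply (Rmult_le_reg_r x); [lra|].
      rewrite <- (Rabs_pos_eq x) at 3 by lra. rewrite <- Rabs_mult.
      eapply Rle_trans; [|apply IH; lra]. right. f_equal. field. lra.
    + rewrite partial_0. replace (int0 g 0) with 0 by (symmetry; apply (RInt_point 0 (slope g))). ring.
    + ring.
    + apply Ht.
Qed.

Lemma partial_approximates_li (s1 : Z) (rest : list Z) :
  s1 <> 0%Z -> List.Forall (Z.lt 0) rest ->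
  exists eps, is_lim_seq eps 0 /\
    forall N t, 0 <= t <= 1 ->
      Rabs (approx (s1 :: rest) N t - li (s1 :: rest) t) <= eps N * t.
Proof.
  intros Hs1 Hr; revert s1 Hs1.
  induction Hr as [|r1 rest Hr1 Hr IH]; intros s1 Hs1;
    simpl; replace (Z.abs_nat s1) with (S (pred (Z.abs_nat s1))) by lia;
    apply partial_approximates_iter; auto.
  - exists (fun _ => 0). split; [apply is_lim_seq_const|].
    intros N t _. simpl. rewrite Rminus_diag, Rabs_R0. lra.
  - destruct (IH r1) as [eps [Heps H]]; [lia|].
    exists eps. split; auto. intros N t Ht.
    eapply Rle_trans; [now apply H|].
    (* Nonnegativity of [eps N] is read off the estimate at [t = 1]; it allows the factor [t] to be
       replaced by [1]. *)
    assert (0 <= eps N) by (specialize (H N 1); generalize (Rabs_pos (approx (r1 :: rest) N 1 - li (r1 :: rest) 1)); lra).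
    rewrite <- (Rmult_1_r (eps N)) at 2. apply Rmult_le_compat_l; lra.
Qed.

(** The sign [(-1) ^ n] of a barred first entry is the power [(- t) ^ n] at [t = 1], where the
    uniform estimate gives convergence. *)
Lemma mzv_li (s1 : Z) (rest : list Z) :
  (s1 < 0)%Z -> List.Forall (Z.lt 0) rest -> mzv (s1 :: rest) = li (s1 :: rest) 1.
Proof.
  intros Hs1 Hr.
  destruct (partial_approximates_li s1 rest) as [eps [Heps H]]; [lia|auto|].
  unfold mzv. rewrite (is_lim_seq_unique _ (Finite (li (s1 :: rest) 1))); [reflexivity|].
  apply (is_lim_seq_ext (fun N => (approx (s1 :: rest) N 1 - li (s1 :: rest) 1)
                                  + li (s1 :: rest) 1)).
  { intros N. rewrite mzv_trunc_neg by auto. simpl. ring. }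
  evar_last; [apply is_lim_seq_plus'; [|apply is_lim_seq_const]|f_equal; apply Rplus_0_l].
  apply is_lim_seq_abs_0.
  refine (is_lim_seq_le_le (fun _ => 0) _ eps 0 _ (is_lim_seq_const 0) Heps).
  intros N. split; [apply Rabs_pos|]. generalize (H N 1). lra.
Qed.

(** * Telescoping derivatives and powers of the logarithm *)

Lemma slope_swap (f g : R -> R) (t : R) :
  f 0 = 0 -> g 0 = 0 -> f t * slope g t = slope f t * g t.
Proof.
  intros Hf Hg. unfold slope. destruct (Req_EM_T t 0) as [->|Ht].
  - rewrite Hf, Hg. ring.
  - field. auto.
Qed.

(** Differentiation lowers the index in both families, with opposite factors [q] and [- q]. In the
    product rule neighbouring terms therefore cancel, and only those with [da0] and [db0]
    survive. *)
Lemma is_derive_convolution (a b : nat -> R -> R) (q da0 db0 t : R) (n : nat) :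
  is_derive (a 0%nat) t da0 -> is_derive (b 0%nat) t db0 ->
  (forall i, is_derive (a (S i)) t (q * a i t)) ->
  (forall i, is_derive (b (S i)) t (- q * b i t)) ->
  is_derive (fun u => sum_range 0 (S n) (fun i => a i u * b (n - i)%nat u)) t
            (da0 * b n t + a n t * db0).
Proof.
  intros Ha0 Hb0 Ha Hb.
  pose (da := fun i => match i with O => da0 | S j => q * a j t end).
  pose (db := fun i => match i with O => db0 | S j => - q * b j t end).
  replace (da0 * b n t + a n t * db0) with
    (sum_range 0 (S n) (fun i => da i * b (n - i)%nat t + a i t * db (n - i)%nat)).
  - apply (is_derive_sum_range 0 (S n) (fun i u => a i u * b (n - i)%nat u)
      (fun i _ => da i * b (n - i)%nat t + a i t * db (n - i)%nat)).
    intros i _. apply (is_derive_mult (a i) (b (n - i)%nat)).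
    + destruct i; [exact Ha0|apply Ha].
    + destruct (n - i)%nat; [exact Hb0|apply Hb].
    + intros; apply Rmult_comm.
  - rewrite sum_range_plus, sum_range_S, sum_range_Sr, sum_range_shift.
    (* The term that differentiates [b] at index [i] is minus the one that differentiates [a] at
       index [S i]. *)
    rewrite (sum_range_ext 0 n (fun i => a i t * db (n - i)%nat)
      (fun i => -1 * (da (S i) * b (n - S i)%nat t))).
    + rewrite sum_range_scal. simpl (0 + n)%nat. rewrite Nat.sub_0_r, Nat.sub_diag.
      simpl. ring.
    + intros i Hi. replace (n - i)%nat with (S (n - S i)) by lia. simpl. ring.
Qed.

Definition log_pow (i : nat) (t : R) : R := ln (1 + t) ^ i / INR (fact i).

Lemma is_derive_log_pow (i : nat) (t : R) : -1 < t ->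
  is_derive (log_pow (S i)) t (/ (1 + t) * log_pow i t).
Proof.
  intros Ht. unfold log_pow.
  assert (Hi : INR (S i) <> 0) by (apply not_0_INR; lia).
  assert (Hf := INR_fact_neq_0 i).
  apply (is_derive_ext (fun t => / INR (fact (S i)) * ln (1 + t) ^ S i)).
  { intros u. apply Rmult_comm. }
  evar_last.
  - apply (is_derive_scal (fun t => ln (1 + t) ^ S i)).
    apply (is_derive_pow (fun t => ln (1 + t)) (S i) t (/ (1 + t))).
    auto_derive; [lra|field; lra].
  - cbn [pred]. rewrite fact_simpl, mult_INR. field. repeat split; auto; lra.
Qed.

(** By induction both sides have the same derivative on [[0,t]], and for [n > 0] both vanish at
    [0]. *)
Lemma li_ones (n : nat) (t : R) : 0 <= t ->
  li (ones n) t = (-1) ^ n * log_pow n t.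
Proof.
  revert t; induction n as [|n IH]; intros t Ht; [unfold log_pow; simpl; field|].
  assert (H0 : li (ones (S n)) 0 - (-1) ^ S n * log_pow (S n) 0 = 0).
  { change (ones (S n)) with (1%Z :: ones n). rewrite li_0. unfold log_pow. rewrite Rplus_0_r, ln_1, pow_i by lia.
    unfold Rdiv. ring. }
  destruct (Req_dec t 0) as [->|Hne]; [lra|].
  enough (H : li (ones (S n)) 0 - (-1) ^ S n * log_pow (S n) 0
            = li (ones (S n)) t - (-1) ^ S n * log_pow (S n) t) by lra.
  apply (eq_is_derive (fun t => li (ones (S n)) t - (-1) ^ S n * log_pow (S n) t)); [|lra].
  intros x Hx. evar_last.
  - apply (is_derive_minus (li (ones (S n))) (fun t => (-1) ^ S n * log_pow (S n) t)).
    + apply is_derive_li_1. lra.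
    + apply (is_derive_scal (log_pow (S n))), is_derive_log_pow. lra.
  - change (- li (ones n) x / (1 + x) - (-1) ^ S n * (/ (1 + x) * log_pow n x) = 0).
    rewrite IH by lra. simpl. field. lra.
Qed.

(* With [ln 2] replaced by [ln (1 + t)], the powers of the logarithm cancel the
   leading ones of the words by telescoping. *)
Lemma is_derive_log_sum (n : nat) (s : list Z) (t : R) : -1 < t ->
  is_derive (fun u => sum_range 0 (S n)
               (fun i => log_pow i u * li (ones (n - i) ++ 2%Z :: s) u)) t
            (log_pow n t * slope (li (1%Z :: s)) t).
Proof.
  intros Ht. evar_last.
  - apply (is_derive_convolution log_pow (fun j => li (ones j ++ 2%Z :: s))
      (/ (1 + t)) 0 (slope (li (1%Z :: s)) t)).
    + apply (is_derive_ext (fun _ => 1)); [|apply (is_derive_const 1)].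
      intros u. unfold log_pow. simpl. symmetry. apply Rdiv_1_r.
    + now apply is_derive_li_2.
    + intros i. now apply is_derive_log_pow.
    + intros i. now apply is_derive_li_ones.
  - simpl. ring.
Qed.

(** The alternating sign in the first family turns its factor [- / (1 + t)] into the opposite of
    that of the second, as the telescoping requires. *)
Lemma is_derive_li_convolution (p m k : nat) (t : R) : -1 < t ->
  is_derive (fun u => sum_range 0 (S p)
      (fun i => ((-1) ^ i * li (ones i ++ 2%Z :: ones m) u)
                * li (ones (p - i) ++ 2%Z :: ones k) u)) t
    (slope (li (ones (S m))) t * li (ones p ++ 2%Z :: ones k) t
     + (-1) ^ p * li (ones p ++ 2%Z :: ones m) t * slope (li (ones (S k))) t).
Proof.
  intros Ht.
  apply (is_derive_convolution (fun i u => (-1) ^ i * li (ones i ++ 2%Z :: ones m) u)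
    (fun j => li (ones j ++ 2%Z :: ones k)) (/ (1 + t))).
  - apply (is_derive_ext (li (2%Z :: ones m))).
    + intros u. symmetry. apply Rmult_1_l.
    + now apply is_derive_li_2.
  - now apply is_derive_li_2.
  - intros i. evar_last; [apply (is_derive_scal (li (ones (S i) ++ 2%Z :: ones m))); now apply is_derive_li_ones|].
    rewrite <- tech_pow_Rmult. ring.
  - intros i. now apply is_derive_li_ones.
Qed.

(** * The identity between polylogarithms *)

Lemma pow_neg1_cases (n : nat) : (-1) ^ n = 1 \/ (-1) ^ n = -1.
Proof. induction n as [|n [H|H]]; simpl; [left|right|left]; try rewrite H; ring. Qed.

Lemma li_leading_2 (j : nat) (s : list Z) : li (ones j ++ 2%Z :: s) 0 = 0.
Proof. destruct j; apply li_0. Qed.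

Lemma sum_range_0 (a n : nat) (f : nat -> R) :
  (forall i, f i = 0) -> sum_range a n f = 0.
Proof.
  intros H. rewrite (sum_range_ext a n f (fun _ => 0 * 0)).
  - rewrite sum_range_scal. ring.
  - intros; rewrite H; ring.
Qed.

(** This is the theorem divided by the factorials, with the separate [ln 2] terms and the products
    of zeta values absorbed as end terms of the sums. The difference [H] of the two sides, as a
    function of [t], is constant on [[0,1]] and zero at [0]. *)
Lemma log_sums_eq_li_convolution (m k p : nat) :
  (-1) ^ (k + p) * sum_range 0 (S (S m)) (fun i => log_pow i 1 *
      li (ones (S m - i) ++ 2%Z :: ones p ++ 2%Z :: ones k) 1)
  + (-1) ^ (m + 1) * sum_range 0 (S (S k)) (fun i => log_pow i 1 *
      li (ones (S k - i) ++ 2%Z :: ones p ++ 2%Z :: ones m) 1)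
  = (-1) ^ (m + k + p + 1) * sum_range 0 (S (S p))
      (fun i => ((-1) ^ i * li (ones i ++ 2%Z :: ones m) 1)
                * li (ones (S p - i) ++ 2%Z :: ones k) 1).
Proof.
  pose (A := fun m k t => sum_range 0 (S (S m)) (fun i => log_pow i t *
      li (ones (S m - i) ++ 2%Z :: ones p ++ 2%Z :: ones k) t)).
  pose (C := fun t => sum_range 0 (S (S p))
      (fun i => ((-1) ^ i * li (ones i ++ 2%Z :: ones m) t)
                * li (ones (S p - i) ++ 2%Z :: ones k) t)).
  pose (H := fun t => (-1) ^ (k + p) * A m k t + (-1) ^ (m + 1) * A k m t
                      - (-1) ^ (m + k + p + 1) * C t).
  assert (HA : forall m k, A m k 0 = 0).
  { intros. apply sum_range_0. intros. rewrite li_leading_2. ring. }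
  assert (HC : C 0 = 0).
  { apply sum_range_0. intros. rewrite li_leading_2. ring. }
  enough (HH : H 0 = H 1).
  { unfold H in HH. rewrite !HA, HC in HH. unfold A, C in HH. lra. }
  apply (eq_is_derive H); [|lra]. intros t Ht. evar_last.
  - apply (is_derive_minus (fun t => (-1) ^ (k + p) * A m k t + (-1) ^ (m + 1) * A k m t)
             (fun t => (-1) ^ (m + k + p + 1) * C t)).
    + apply (is_derive_plus (fun t => (-1) ^ (k + p) * A m k t)
               (fun t => (-1) ^ (m + 1) * A k m t));
        apply (is_derive_scal (A _ _)), is_derive_log_sum; lra.
    + apply (is_derive_scal C), is_derive_li_convolution. lra.
  - change ((-1) ^ (k + p) * (log_pow (S m) t * slope (li (ones (S p) ++ 2%Z :: ones k)) t)
      + (-1) ^ (m + 1) * (log_pow (S k) t * slope (li (ones (S p) ++ 2%Z :: ones m)) t)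
      - (-1) ^ (m + k + p + 1) *
        (slope (li (ones (S m))) t * li (ones (S p) ++ 2%Z :: ones k) t
         + (-1) ^ S p * li (ones (S p) ++ 2%Z :: ones m) t * slope (li (ones (S k))) t) = 0).
    (* The power of the logarithm is, up to sign, a polylogarithm vanishing at [0], so the division
       by [t] can be moved onto it. *)
    assert (Hswap : forall n s, log_pow (S n) t * slope (li (ones (S p) ++ 2%Z :: s)) t
      = (-1) ^ S n * (slope (li (ones (S n))) t * li (ones (S p) ++ 2%Z :: s) t)).
    { intros n s. rewrite <- slope_swap by apply li_0.
      rewrite li_ones by lra. destruct (pow_neg1_cases (S n)) as [->| ->]; ring. }
    (* What remains depends on [m], [k] and [p] in the signs only through their parities. *)
    rewrite !Hswap. rewrite !pow_add, <- !tech_pow_Rmult, !pow_O.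
    destruct (pow_neg1_cases m) as [->| ->], (pow_neg1_cases k) as [->| ->],
      (pow_neg1_cases p) as [->| ->]; ring.
Qed.

(** * Return to zeta values at [t = 1] *)

Lemma Forall_ones_app (j : nat) (s : list Z) :
  List.Forall (Z.lt 0) s -> List.Forall (Z.lt 0) (ones j ++ s).
Proof.
  intros Hs. induction j as [|j IH]; [exact Hs|]. constructor; [lia|exact IH].
Qed.

Lemma Forall_ones (j : nat) : List.Forall (Z.lt 0) (ones j).
Proof. induction j as [|j IH]; constructor; auto. lia. Qed.

(** For [i <= n] a leading one of the word becomes the barred [1]; at [i = n + 1] no leading one is
    left and the [2] itself is barred. *)
Lemma mzv_log_sum (n : nat) (s : list Z) : List.Forall (Z.lt 0) s ->
  sum_range 0 (n + 1) (fun i => ln 2 ^ i / INR (fact i)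
      * mzv ((-1)%Z :: ones (n - i) ++ 2%Z :: s))
  + ln 2 ^ (n + 1) / INR (fact (n + 1)) * mzv ((-2)%Z :: s)
  = sum_range 0 (S (S n)) (fun i => log_pow i 1 * li (ones (S n - i) ++ 2%Z :: s) 1).
Proof.
  intros Hs. rewrite Nat.add_1_r, (sum_range_Sr 0 (S n)), Nat.add_0_l, Nat.sub_diag.
  unfold log_pow. replace (1 + 1) with 2 by ring. f_equal.
  - apply sum_range_ext. intros i Hi. f_equal.
    rewrite mzv_li; [|lia|now apply Forall_ones_app; constructor].
    replace (S n - i)%nat with (S (n - i)) by lia. reflexivity.
  - now rewrite mzv_li.
Qed.

Theorem theorem4p3 (m k p : nat) :
  (-1) ^ (k + p) * INR (fact (m + 1)) * INR (fact (k + 1)) *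
    sum_range 0 (m + 1) (fun i => (ln 2) ^ i / INR (fact i) *
      mzv ([(-1)%Z] ++ ones (m - i) ++ [2%Z] ++ ones p ++ [2%Z] ++ ones k))
  + (-1) ^ (m + 1) * INR (fact (k + 1)) * INR (fact (m + 1)) *
    sum_range 0 (k + 1) (fun i => (ln 2) ^ i / INR (fact i) *
      mzv ([(-1)%Z] ++ ones (k - i) ++ [2%Z] ++ ones p ++ [2%Z] ++ ones m))
  + (-1) ^ (k + p) * INR (fact (k + 1)) * (ln 2) ^ (m + 1) *
      mzv ([(-2)%Z] ++ ones p ++ [2%Z] ++ ones k)
  + (-1) ^ (m + 1) * INR (fact (m + 1)) * (ln 2) ^ (k + 1) *
      mzv ([(-2)%Z] ++ ones p ++ [2%Z] ++ ones m)
  =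
  (-1) ^ (m + k + p + 1) * INR (fact (m + 1)) * INR (fact (k + 1)) *
    mzv ([(-2)%Z] ++ ones m) * mzv ([(-1)%Z] ++ ones p ++ [2%Z] ++ ones k)
  + (-1) ^ (m + k) * INR (fact (k + 1)) * INR (fact (m + 1)) *
    mzv ([(-2)%Z] ++ ones k) * mzv ([(-1)%Z] ++ ones p ++ [2%Z] ++ ones m)
  + (-1) ^ (m + k + p + 1) * INR (fact (k + 1)) * INR (fact (m + 1)) *
    sum_range 1 p (fun i => (-1) ^ i *
      mzv ([(-1)%Z] ++ ones (i - 1) ++ [2%Z] ++ ones m) *
      mzv ([(-1)%Z] ++ ones (p - i) ++ [2%Z] ++ ones k)).
Proof.
  assert (Hpos : forall j n, List.Forall (Z.lt 0) (ones j ++ 2%Z :: ones n)).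
  { intros j n. apply Forall_ones_app. constructor; [lia|apply Forall_ones]. }
  assert (Hconv : sum_range 0 (S (S p))
      (fun i => ((-1) ^ i * li (ones i ++ 2%Z :: ones m) 1)
                * li (ones (S p - i) ++ 2%Z :: ones k) 1)
    = mzv ((-2)%Z :: ones m) * mzv ((-1)%Z :: ones p ++ 2%Z :: ones k)
      + sum_range 1 p (fun i => (-1) ^ i * mzv ((-1)%Z :: ones (i - 1) ++ 2%Z :: ones m)
          * mzv ((-1)%Z :: ones (p - i) ++ 2%Z :: ones k))
      + (-1) ^ S p * (mzv ((-1)%Z :: ones p ++ 2%Z :: ones m) * mzv ((-2)%Z :: ones k))).
  (* The end terms [i = 0] and [i = p + 1] are the products containing a barred [2]; the others form
     the sum over [1 <= i <= p]. *)
  { rewrite sum_range_S, sum_range_Sr. change (1 + p)%nat with (S p).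
    rewrite Nat.sub_diag, <- !Rplus_assoc. f_equal; [f_equal|].
    - rewrite !mzv_li by (auto using Forall_ones; lia). simpl ((-1) ^ 0).
      rewrite Rmult_1_l. reflexivity.
    - apply sum_range_ext. intros i Hi. rewrite !mzv_li by (auto; lia).
      replace (S p - i)%nat with (S (p - i)) by lia.
      destruct i as [|i]; [lia|]. replace (S i - 1)%nat with i by lia. reflexivity.
    - rewrite !mzv_li by (auto using Forall_ones; lia). apply Rmult_assoc. }
  assert (E := log_sums_eq_li_convolution m k p).
  rewrite Hconv, <- !mzv_log_sum in E by auto. simpl app in *.
  assert (Hm := INR_fact_neq_0 (m + 1)). assert (Hk := INR_fact_neq_0 (k + 1)).
  set (M := INR (fact (m + 1))) in *. set (K := INR (fact (k + 1))) in *.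
  (* Multiplying by both factorials clears the denominators of the top powers of [ln 2]. *)
  match type of E with ?l = ?r =>
    transitivity (M * K * l); [field; auto|rewrite E] end.
  rewrite !pow_add, <- !tech_pow_Rmult, !pow_O.
  (* The parity of [p] settles [(-1) ^ (m + k + p + 1) * (-1) ^ (p + 1) = (-1) ^ (m + k)], the sign
     of the second product. *)
  destruct (pow_neg1_cases p) as [->| ->]; ring.
Qed.
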